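(* Assume that $J$ is Lasry--Lions monotone, i.e. $\langle J(\mu,\cdot)-J(\nu,\cdot),\mu-\nu\rangle\ge 0$ for all $\mu,\nu\in\mathcal P(\Omega)$; that there is $L_m>0$ with $\|J(\mu,\cdot)-J(\nu,\cdot)\|_\infty\le L_mW_1(\mu,\nu)$ for all $\mu,\nu\in\mathcal P(\Omega)$; and that there is $L_x>0$ with $|J(\rho,x)-J(\rho,y)|\le L_x|x-y|$ for all $\rho\in\mathcal P(\Omega)$ and $x,y\in\Omega$. Let $(X_h)_{h>0}$ be a family of finite subsets of $\Omega$ and, for each $h>0$, let $Q_h:\Omega\to X_h$ be a measurable map with $\sup_{x\in\Omega}|Q_h(x)-x|\le h$. For each $h>0$ let $\mu_{0,h}\in\mathcal P(X_h)$ satisfy $\mu_{0,h}(\{x\})>0$ for all $x\in X_h$, and set $m_h:=\min_{x\in X_h}\mu_{0,h}(\{x\})$. Let $0<\lambda<\frac{1}{L_mD_\Omega}$ and let $(\mu_{k,h},\nu_{k,h})_{k\ge0}$ be the KL Mirror-Prox iterates with stepsize $\lambda$ initialized from $\mu_{0,h}$. For $h>0$, $K\ge1$ define $$\bar\nu_{K,h}:=\frac1K\sum_{k=0}^{K-1}\nu_{k,h},\qquad \varepsilon_{K,h}:=\frac{\log(1/m_h)}{\lambda K}+(2L_m+L_x)h.$$ (a) Whenever $\varepsilon_{K,h}\le 2L_mD_\Omega$, $\bar\nu_{K,h}$ is a $\delta_{K,h}$-mean field equilibrium with $\delta_{K,h}:=2\sqrt{2L_mD_\Omega\,\varepsilon_{K,h}}$.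 (b) Given any $\delta>0$, let $\varepsilon_\delta^\star:=\min\left\{2L_mD_\Omega,\frac{\delta^2}{8L_mD_\Omega}\right\}$. If $$h\le\frac{\varepsilon_\delta^\star}{2(2L_m+L_x)}\qquad\text{and}\qquad K\ge\frac{2\log(1/m_h)}{\lambda\varepsilon_\delta^\star},$$ then $\varepsilon_{K,h}\le\varepsilon_\delta^\star$ and $\delta_{K,h}\le\delta$, and consequently $\bar\nu_{K,h}$ is a $\delta$-mean field equilibrium.
   Context: $\Omega\subset\mathbb R^d$ is a nonempty compact set with $D_\Omega:=\sup_{x,y\in\Omega}|x-y|>0$, and $\mathcal P(\Omega)$ is the set of Borel probability measures on $\Omega$. $J:\mathcal P(\Omega)\times\Omega\to\mathbb R$ is such that $J(\mu,\cdot)\in C(\Omega)$ for every $\mu\in\mathcal P(\Omega)$. For $f\in C(\Omega)$ and a finite signed measure $\xi$, $\langle f,\xi\rangle:=\int_\Omega f\,d\xi$. $W_1$ is the 1-Wasserstein distance on $\mathcal P(\Omega)$ for the Euclidean distance. For $X_h\subset\Omega$, $\mathcal P(X_h)$ is identified with the set of measures in $\mathcal P(\Omega)$ supported on $X_h$. For $\varepsilon\ge0$, $\mu\in\mathcal P(\Omega)$ is an $\varepsilon$-mean field equilibrium if $\int_\Omega J(\mu,x)\,\mu(dx)\le\min_{x\in\Omega}J(\mu,x)+\varepsilon$. KL Mirror-Prox iterates with stepsize $\lambda>0$ initialized from a probability measure $\mu_0$: for $k=0,1,2,\dots$, $$\nu_k(dx)=\frac{e^{-\lambda J(\mu_k,x)}\mu_k(dx)}{\int_\Omega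 e^{-\lambda J(\mu_k,z)}\mu_k(dz)},\qquad \mu_{k+1}(dx)=\frac{e^{-\lambda J(\nu_k,x)}\mu_k(dx)}{\int_\Omega e^{-\lambda J(\nu_k,z)}\mu_k(dz)}.$$ When $\mu_0=\mu_{0,h}$ is supported on the finite set $X_h$, all iterates are measures on $X_h$ (the integrals are finite sums). *)

(* Defs.v *)
From HB Require Import structures.
From mathcomp Require Import all_boot all_order all_algebra.
From mathcomp Require Import all_classical all_reals all_analysis.
Set Implicit Arguments.
Unset Strict Implicit.
Unset Printing Implicit Defensive.
Import Order.TTheory GRing.Theory Num.Theory.
Import numFieldNormedType.Exports.
Local Open Scope classical_set_scope.
Local Open Scope ring_scope.

(* R^d carries its Borel sigma-algebra. The library topology on ['rV[R]_d] is
   that of the sup norm, which is also the Euclidean topology. *)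
HB.instance Definition _ (R : realType) (d : nat) :=
  @isMeasurable.Build (sigma_display (@open 'rV[R]_d)) 'rV[R]_d
    <<s @open 'rV[R]_d >> (@sigma_algebra0 _ setT _)
    (@sigma_algebraC _ (@open 'rV[R]_d)) (@sigma_algebra_bigcup _ setT _).

(* The norm [`|x - y|] of the library is the sup norm, so the Euclidean
   distance is defined here. *)
Definition eucl_dist (R : realType) (d : nat) (x y : 'rV[R]_d) : R :=
  Num.sqrt (\sum_(i < d) (x ord0 i - y ord0 i) ^+ 2).

Definition diam (R : realType) (d : nat) (A : set 'rV[R]_d) : R :=
  sup [set eucl_dist x y | x in A & y in A].

Definition supnorm (R : realType) (T : Type) (A : set T) (f : T -> R) : \bar R :=
  ereal_sup [set `|f x|%:E | x in A].

(* Borel probability measures on [A], as Borel probability measures on R^d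
   giving full mass to [A]; for a finite [A] these are the probability measures
   supported on [A]. *)
Definition probs (R : realType) (d : nat) (A : set 'rV[R]_d) :
    set (probability 'rV[R]_d R) :=
  [set mu | mu A = 1%E].

Section wasserstein.
Variables (R : realType) (d : nat).
Implicit Types mu nu : probability 'rV[R]_d R.

Definition couplings mu nu :
    set (probability ('rV[R]_d * 'rV[R]_d)%type R) :=
  [set pi | (forall A, measurable A -> pi (A `*` setT) = mu A) /\
            (forall B, measurable B -> pi (setT `*` B) = nu B)].

(* A coupling of two elements of [probs A] gives full mass to [A `*` A], so on
   [probs A] this is the 1-Wasserstein distance of [A]. *)
Definition W1 mu nu : \bar R :=
  ereal_inf [set (\int[pi]_z (eucl_dist z.1 z.2)%:E)%E | pi in couplings mu nu].

End wasserstein.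

Section mean_field.
Variables (R : realType) (d : nat) (Omega : set 'rV[R]_d).
Variable J : probability 'rV[R]_d R -> 'rV[R]_d -> R.
Implicit Types mu nu : probability 'rV[R]_d R.

Definition pairing (f : 'rV[R]_d -> R) mu : R := \int[mu]_(x in Omega) f x.

(* [< f, mu - nu >] is [pairing f mu - pairing f nu]. *)
Definition lasry_lions_monotone : Prop :=
  forall mu nu, probs Omega mu -> probs Omega nu ->
    let f x := J mu x - J nu x in
    0 <= pairing f mu - pairing f nu.

(* The infimum is a minimum, as [J mu] is continuous on the compact [Omega]. *)
Definition mean_field_equilibrium (eps : R) mu : Prop :=
  probs Omega mu /\
  \int[mu]_(x in Omega) J mu x <= inf [set J mu x | x in Omega] + eps.

(* [nu] is the normalization of the measure [exp(- lambda f(x)) mu(dx)] on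
   [Omega]. *)
Definition is_gibbs (lambda : R) (f : 'rV[R]_d -> R) mu nu : Prop :=
  forall A, measurable A ->
    nu A = ((\int[mu]_(x in A `&` Omega) expR (- lambda * f x)) /
            (\int[mu]_(z in Omega) expR (- lambda * f z)))%:E.

Definition KL_mirror_prox (lambda : R) (mu0 : probability 'rV[R]_d R)
    (mu nu : nat -> probability 'rV[R]_d R) : Prop :=
  mu 0%N = mu0 /\
  forall k, is_gibbs lambda (J (mu k)) (mu k) (nu k) /\
            is_gibbs lambda (J (nu k)) (mu k) (mu k.+1).

End mean_field.

(* The total mass of [\sum_(k < K) nu k] is [K], so normalizing it divides by
   [K] (see [averageE]); the last argument of [mnormalize] is only a default
   value, used when [K = 0]. *)
Definition average (R : realType) (d : nat)
    (nu : nat -> probability 'rV[R]_d R) (K : nat) : probability 'rV[R]_d R :=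
  mnormalize (msum nu K) (nu 0%N).

Lemma averageE (R : realType) (d : nat)
    (nu : nat -> probability 'rV[R]_d R) (K : nat) (A : set 'rV[R]_d) :
  (0 < K)%N ->
  average nu K A = ((K%:R^-1)%:E * \sum_(k < K) nu k A)%E.
Proof.
move=> K0; rewrite /average /= /mnormalize /=.
have mK : msum nu K setT = K%:R%:E :> \bar R.
  rewrite /msum (eq_bigr (fun=> 1%E)); last by move=> i _; exact: probability_setT.
  by rewrite sumEFin big_const_ord iter_addr_0.
by rewrite !mK /= eqe pnatr_eq0 -leqn0 leqNgt K0 /= muleC.
Qed.

(* Main.v *)
Require Import Defs.
From HB Require Import structures.
From mathcomp Require Import all_boot all_order all_algebra.
From mathcomp Require Import all_classical all_reals all_analysis.
From mathcomp Require Import measurable_realfun ring lra.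
Set Implicit Arguments.
Unset Strict Implicit.
Unset Printing Implicit Defensive.
Import Order.TTheory GRing.Theory Num.Theory.
Import numFieldNormedType.Exports.
Local Open Scope classical_set_scope.
Local Open Scope ring_scope.

(** Both parts follow from an estimate of the dual gap. Call
    [<J(rho), sigma - rho>] the gap of [sigma] against [rho].

    On the finite set [X h] the iterates have positive masses, and each of the
    two entropic updates subtracts [lambda * J] and a constant from the logarithm
    of the masses. For a probability [rho] on [X h] this turns
    [lambda * <J(nu_k), nu_k - rho>] into the increment from [k] to [k.+1] of
    [sum_x rho(x) * ln (mu_k(x))], minus [KL(mu_k.+1 | nu_k) + KL(nu_k | mu_k)],
    plus [lambda * <J(nu_k) - J(mu_k), nu_k - mu_k.+1>]. The last term is at most
    the two divergences: [W1] is at most the diameter times the total variation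
    ([W1_le_total_variation]), the squared total variation is at most the
    divergence ([pinsker]), and [lambda * Lm * diam Omega <= 1]
    ([mirror_prox_step]). Only the increment is left, so the sum over [k < K]
    telescopes to at most [ln (1 / m)]. By monotonicity [J(nu_k)] may be
    replaced with [J(rho)], and then averaging over [k] bounds the gap of the
    averaged iterate against [rho] by [ln (1 / m) / (lambda * K)]
    ([mirror_prox_dual_gap]).

    To reach a point [x] of [Omega], test the average [sigma] against the
    mixture [P = (1 - t) sigma + t delta_x]. Moving [x] to a point [y] of
    [X h] at distance at most [h] changes [P] by at most [t * h] in [W1], which
    gives the error [(2 * Lm + Lx) * h], and
    [<J(P), sigma - P> = t * <J(P), sigma - delta_x>]. Since [P] is within
    [t * diam Omega] of [sigma], replacing [J(P)] with [J(sigma)] yields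
    [<J(sigma), sigma - delta_x> <= eps / t + 2 * Lm * t * diam Omega], and
    minimizing over [t] gives [2 * sqrt (2 * Lm * diam Omega * eps)]
    ([equilibrium_of_dual_gap]). *)

(** * Finitely supported measures *)

(** The points [z i] may coincide, so that the marginals of a coupling are
    described over the index sequence of the coupling itself. *)
Definition discrete d (T : measurableType d) (R : realType) (I : Type)
    (P : set T -> \bar R) (r : seq I) (w : I -> R) (z : I -> T) : Prop :=
  forall A, measurable A -> P A = (\sum_(i <- r) w i * \1_A (z i))%:E.

Fixpoint dirac_sum d (T : measurableType d) (R : realType) (I : Type)
    (r : seq I) (w : I -> {nonneg R}) (z : I -> T) : measure T R :=
  if r is i :: r' then
    measure_add (mscale (w i) (dirac (z i))) (dirac_sum r' w z)
  else mzero.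

Lemma dirac_sumE d (T : measurableType d) (R : realType) (I : Type)
    (r : seq I) (w : I -> {nonneg R}) (z : I -> T) :
  discrete (dirac_sum r w z) r (fun i => (w i)%:num) z.
Proof.
move=> A mA; elim: r => [|i r IH]; first by rewrite big_nil.
rewrite big_cons EFinD -IH EFinM indicE -diracE.
exact: measure_addE.
Qed.

Lemma ge0_integral_dirac_sum d (T : measurableType d) (R : realType)
    (I : Type) (r : seq I) (w : I -> {nonneg R}) (z : I -> T)
    (D : set T) (f : T -> R) :
  measurable D -> measurable_fun D f -> (forall x, D x -> 0 <= f x) ->
  (\int[dirac_sum r w z]_(x in D) (f x)%:E =
   (\sum_(i <- r) (w i)%:num * \1_D (z i) * f (z i))%:E)%E.
Proof.
move=> mD mf f0; have mf' : measurable_fun D (EFin \o f) by exact/measurable_EFinP.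
have f0' x : D x -> (0 <= (f x)%:E)%E by move=> /f0; rewrite lee_fin.
elim: r => [|i r IH] /=; first by rewrite big_nil integral_measure_zero.
rewrite ge0_integral_measure_add//= IH ge0_integral_mscale//= integral_dirac//.
by rewrite big_cons EFinD !EFinM diracE indicE muleA.
Qed.

Lemma ge0_discrete_integral d (T : measurableType d) (R : realType)
    (I : Type) (P : {measure set T -> \bar R}) (r : seq I) (w : I -> R)
    (z : I -> T) (D : set T) (f : T -> R) :
  (forall i, 0 <= w i) -> discrete P r w z ->
  measurable D -> measurable_fun D f -> (forall x, D x -> 0 <= f x) ->
  (\int[P]_(x in D) (f x)%:E = (\sum_(i <- r) w i * \1_D (z i) * f (z i))%:E)%E.
Proof.
move=> w0 Pd mD mf f0.
rewrite (eq_measure_integral (dirac_sum r (fun i => NngNum (w0 i)) z)).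
  by rewrite ge0_integral_dirac_sum.
by move=> A mA _; rewrite Pd// dirac_sumE.
Qed.

(** The positive and negative parts are integrated separately, so that
    integrability need not be established first. *)
Lemma discrete_integral d (T : measurableType d) (R : realType)
    (I : Type) (P : {measure set T -> \bar R}) (r : seq I) (w : I -> R)
    (z : I -> T) (D : set T) (f : T -> R) :
  (forall i, 0 <= w i) -> discrete P r w z ->
  measurable D -> measurable_fun D f ->
  \int[P]_(x in D) f x = \sum_(i <- r) w i * \1_D (z i) * f (z i).
Proof.
move=> w0 Pd mD mf; pose fp x := Num.max (f x) 0; pose fn x := Num.max (- f x) 0.
have m0 : measurable_fun D (fun=> 0 : R) by exact: measurable_cst.
have mfp : measurable_fun D fp by exact: measurable_maxr.
have mfn : measurable_fun D fn.
  by apply: measurable_maxr => //; exact: measurableT_comp.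
have pE : (fun x => (f x)%:E)^\+%E = (fun x => (fp x)%:E).
  by apply/funext => x; rewrite funeposE EFin_max.
have nE : (fun x => (f x)%:E)^\-%E = (fun x => (fn x)%:E).
  by apply/funext => x; rewrite funenegE EFin_max.
rewrite /Rintegral integralE pE nE !(ge0_discrete_integral w0 Pd mD)//; last first.
- by move=> x _; rewrite le_max lexx orbT.
- by move=> x _; rewrite le_max lexx orbT.
rewrite -EFinB /= -sumrB; apply: eq_bigr => i _; rewrite -mulrBr; congr (_ * _).
by rewrite /fp /fn; case: (leP (f (z i)) 0); case: (leP (- f (z i)) 0); lra.
Qed.

Lemma discrete_probability d (T : measurableType d) (R : realType)
    (I : Type) (r : seq I) (w : I -> R) (z : I -> T) :
  (forall i, 0 <= w i) -> \sum_(i <- r) w i = 1 ->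
  exists P : probability T R, discrete P r w z.
Proof.
move=> w0 w1; case: r w1 => [|i r] w1.
  by move: w1; rewrite big_nil => /esym/eqP; rewrite oner_eq0.
pose m := dirac_sum (i :: r) (fun i => NngNum (w0 i)) z.
have mT : m setT = 1%E.
  rewrite /m (dirac_sumE _ _ _ measurableT); congr EFin; rewrite -[RHS]w1.
  by apply: eq_bigr => j _; rewrite indicT mulr1.
exists (mnormalize m (dirac (z i))) => A mA.
transitivity (m A); last exact: dirac_sumE.
by rewrite /= /mnormalize mT onee_eq0 /= invr1 mule1.
Qed.

(** * Borel sets and functions on R^d *)

Lemma open_measurable_rV (R : realType) (d : nat) (U : set 'rV[R]_d) :
  open U -> measurable U.
Proof. by move=> oU; exact: sub_sigma_algebra. Qed.

Lemma closed_measurable_rV (R : realType) (d : nat) (U : set 'rV[R]_d) :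
  closed U -> measurable U.
Proof.
move=> cU; rewrite -(setCK U); apply: measurableC.
by apply: open_measurable_rV; exact: closed_openC.
Qed.

Lemma compact_measurable_rV (R : realType) (d : nat) (U : set 'rV[R]_d) :
  compact U -> measurable U.
Proof.
by move=> cU; apply: closed_measurable_rV; exact: compact_closed.
Qed.

Lemma measurable_set1_rV (R : realType) (d : nat) (x : 'rV[R]_d) :
  measurable [set x].
Proof. by apply: compact_measurable_rV; exact: compact_set1. Qed.

Lemma within_continuous_measurable_fun (R : realType) (d : nat)
    (D : set 'rV[R]_d) (f : 'rV[R]_d -> R) :
  measurable D -> {within D, continuous f} -> measurable_fun D f.
Proof.
move=> mD /continuousP cf.
apply: (measurability _ (RGenOpens.measurableE R)).
move=> _ [_ [a [b ->] <-]].
have /cf/open_subspaceP[V oV VD] : open `]a, b[%classic by exact: interval_open.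
by rewrite setIC -VD; apply: measurableI => //; exact: open_measurable_rV.
Qed.

Lemma measurable_eucl_dist (R : realType) (d : nat) :
  measurable_fun setT
    (fun z : 'rV[R]_d * 'rV[R]_d => eucl_dist z.1 z.2).
Proof.
have mc i : measurable_fun setT (fun x : 'rV[R]_d => x ord0 i).
  apply: within_continuous_measurable_fun => //.
  by apply: continuous_subspaceT => x; exact: coord_continuous.
apply: (measurableT_comp (continuous_measurable_fun (@sqrt_continuous R))).
apply: measurable_sum => i; apply: measurable_funX; apply: measurable_funB.
  exact: (measurableT_comp (mc i) measurable_fst).
exact: (measurableT_comp (mc i) measurable_snd).
Qed.

(** * Wasserstein bounds for finitely supported measures *)

Lemma sum_seq_delta (R : pzRingType) (T : eqType) (s : seq T) (F : T -> R) x :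
  uniq s -> x \in s -> \sum_(y <- s) F y * (x == y)%:R = F x.
Proof.
move=> us xs; rewrite (bigD1_seq x)//= eqxx mulr1 big1 ?addr0// => y yx.
by rewrite eq_sym (negbTE yx) mulr0.
Qed.

Lemma eucl_dist_ge0 (R : realType) (d : nat) (x y : 'rV[R]_d) :
  0 <= eucl_dist x y.
Proof. exact: sqrtr_ge0. Qed.

Lemma eucl_distxx (R : realType) (d : nat) (x : 'rV[R]_d) : eucl_dist x x = 0.
Proof.
rewrite /eucl_dist big1 ?sqrtr0// => i _; by rewrite subrr expr0n.
Qed.

(** The measure with mass [w i] at [(x i, y i)] is a coupling. *)
Lemma W1_discrete (R : realType) (d : nat) (mu nu : probability 'rV[R]_d R)
    (I : Type) (r : seq I) (w : I -> R) (x y : I -> 'rV[R]_d) :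
  (forall i, 0 <= w i) -> \sum_(i <- r) w i = 1 ->
  discrete mu r w x -> discrete nu r w y ->
  (W1 mu nu <= (\sum_(i <- r) w i * eucl_dist (x i) (y i))%:E)%E.
Proof.
move=> w0 w1 mux nuy.
have [P Pd] := discrete_probability (fun i => (x i, y i)) w0 w1.
apply: ereal_inf_lbound; exists P; first split.
- move=> A mA; rewrite Pd ?mux//; last exact: measurableX.
  congr EFin; apply: eq_bigr => i _; congr (_ * _).
  by rewrite !indicE in_setX in_setT andbT.
- move=> A mA; rewrite Pd ?nuy//; last exact: measurableX.
  congr EFin; apply: eq_bigr => i _; congr (_ * _).
  by rewrite !indicE in_setX in_setT.
- rewrite (ge0_discrete_integral w0 Pd measurableT (@measurable_eucl_dist R d))/=.
    by congr EFin; apply: eq_bigr => i _; rewrite indicT mulr1.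
  by move=> z _; exact: eucl_dist_ge0.
Qed.

Lemma probs_discrete (R : realType) (d : nat) (A : set 'rV[R]_d)
    (mu : probability 'rV[R]_d R) (I : eqType) (r : seq I) (w : I -> R)
    (z : I -> 'rV[R]_d) :
  measurable A -> discrete mu r w z -> (forall i, i \in r -> A (z i)) ->
  \sum_(i <- r) w i = 1 -> probs A mu.
Proof.
move=> mA mud Az w1; rewrite /probs /= mud// -[in RHS]w1; congr EFin.
apply: eq_big_seq => i ir; rewrite indicE mem_set ?mulr1//; exact: Az.
Qed.

Definition mass (R : realType) (d : nat) (mu : probability 'rV[R]_d R)
  (x : 'rV[R]_d) : R := fine (mu [set x]).

Lemma mass_ge0 (R : realType) (d : nat) (mu : probability 'rV[R]_d R) x :
  0 <= mass mu x.
Proof. by apply: fine_ge0; exact: measure_ge0. Qed.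

Lemma massE (R : realType) (d : nat) (mu : probability 'rV[R]_d R) x :
  mu [set x] = (mass mu x)%:E.
Proof.
by rewrite /mass fineK// fin_num_measure//; exact: measurable_set1_rV.
Qed.

Lemma set_seq_cons (T : eqType) (x : T) (s : seq T) :
  [set` x :: s] = [set x] `|` [set` s].
Proof.
apply/seteqP; split => y /=; rewrite inE; first by move=> /orP[/eqP|]; [left|right].
by case=> [->|->]; rewrite ?eqxx ?orbT.
Qed.

Lemma measurable_set_seq (R : realType) (d : nat) (s : seq 'rV[R]_d) :
  measurable [set` s].
Proof.
elim: s => [|x s IH]; first by rewrite set_nil; exact: measurable0.
by rewrite set_seq_cons; apply: measurableU => //; exact: measurable_set1_rV.
Qed.

Lemma probs_seq_discrete (R : realType) (d : nat) (s : seq 'rV[R]_d)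
    (mu : probability 'rV[R]_d R) :
  uniq s -> probs [set` s] mu -> discrete mu s (mass mu) id.
Proof.
move=> us mus A mA.
have -> : mu A = mu (A `&` [set` s]).
  have ms := measurable_set_seq s.
  rewrite (measureDI mu mA ms) [X in (X + _)%E](_ : _ = 0%E) ?add0e//.
  apply/eqP; rewrite eq_le measure_ge0 andbT.
  have -> : (0 = mu (~` [set` s]))%E by rewrite probability_setC// mus subee.
  rewrite le_measure ?inE//; first exact: measurableD.
  exact: measurableC.
elim: s us {mus} => [|x s IH] /=.
  by rewrite set_nil setI0 measure0 big_nil.
move=> /andP[xs us]; rewrite set_seq_cons setIUr measureU; last first.
- apply/seteqP; split => y //= [[_ ->] [_ xs']].
  by rewrite xs' in xs.
- by apply: measurableI => //; exact: measurable_set_seq.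
- by apply: measurableI => //; exact: measurable_set1_rV.
rewrite big_cons EFinD; congr (_ + _)%E; last exact: IH.
rewrite indicE; case: (boolP (x \in A)) => [|] xA /=.
  rewrite mulr1 -massE; congr (mu _).
  apply/seteqP; split => y /=; first by case.
  by move=> ->; split => //; exact: set_mem.
rewrite mulr0; transitivity (mu set0); last by rewrite measure0.
congr (mu _).
by apply/seteqP; split => y //= [Ay yx]; move: xA; rewrite -yx notin_setE.
Qed.

(** Mass [Num.min (p x) (q x)] stays in place, and the excess of [p] over [q]
    is sent to the excess of [q] over [p] by a product coupling, at a cost of at
    most [D] per unit of mass. *)
Lemma W1_le_total_variation (R : realType) (d : nat) (s : seq 'rV[R]_d)
    (p q : 'rV[R]_d -> R) (mu nu : probability 'rV[R]_d R) (D : R) :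
  uniq s -> (forall x, 0 <= p x) -> (forall x, 0 <= q x) ->
  \sum_(x <- s) p x = 1 -> \sum_(x <- s) q x = 1 ->
  discrete mu s p id -> discrete nu s q id ->
  {in s &, forall x y, eucl_dist x y <= D} ->
  (W1 mu nu <= (D * (2^-1 * \sum_(x <- s) `|p x - q x|))%:E)%E.
Proof.
move=> us p0 q0 p1 q1 mup nuq distD.
pose a x := Num.max (p x - q x) 0; pose b x := Num.max (q x - p x) 0.
have a0 x : 0 <= a x by rewrite le_max lexx orbT.
have b0 x : 0 <= b x by rewrite le_max lexx orbT.
pose t := \sum_(x <- s) a x.
have bt : \sum_(x <- s) b x = t.
  apply/eqP; rewrite -subr_eq0 -sumrB.
  rewrite (eq_bigr (fun x => q x - p x)) ?sumrB ?p1 ?q1 ?subrr// => x _.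
  by rewrite /a /b; case: (leP (p x - q x) 0); case: (leP (q x - p x) 0); lra.
have tE : t = 2^-1 * \sum_(x <- s) `|p x - q x|.
  suff : t + t = \sum_(x <- s) `|p x - q x| by lra.
  rewrite -{2}bt -big_split /=; apply: eq_bigr => x _.
  by rewrite /a /b; case: (ger0P (p x - q x)); case: (leP (p x - q x) 0);
    case: (leP (q x - p x) 0); lra.
have t0 : 0 <= t by exact: sumr_ge0.
have att x : x \in s -> a x * (t / t) = a x.
  move=> xs; have [t_eq0|tn0] := eqVneq t 0; last by rewrite divff ?mulr1.
  (* Here [t / t = 0], but all excesses vanish as well. *)
  move/eqP: t_eq0; rewrite psumr_eq0// => /allP/(_ x xs)/= /eqP ->.
  by rewrite mul0r.
have btt x : x \in s -> b x * (t / t) = b x.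
  move=> xs; have [t_eq0|tn0] := eqVneq t 0; last by rewrite divff ?mulr1.
  move/eqP: t_eq0; rewrite -bt psumr_eq0// => /allP/(_ x xs)/= /eqP ->.
  by rewrite mul0r.
pose w z := Num.min (p z.2) (q z.2) * (z.1 == z.2)%:R + a z.1 * b z.2 / t.
pose r := [seq (x, y) | x <- s, y <- s].
have w0 z : 0 <= w z.
  rewrite addr_ge0// ?mulr_ge0// ?invr_ge0//.
  by rewrite le_min p0 q0.
have row x : x \in s -> \sum_(y <- s) w (x, y) = p x.
  move=> xs; rewrite big_split /= (sum_seq_delta (fun y => Num.min (p y) (q y)))//.
  rewrite (eq_bigr (fun y => b y * (a x / t))) => [|y _]; last by rewrite /=; ring.
  rewrite -mulr_suml bt mulrCA att// /a.
  by case: (leP (p x) (q x)); case: (leP (p x - q x) 0); lra.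
have col y : y \in s -> \sum_(x <- s) w (x, y) = q y.
  move=> ys; rewrite big_split /=.
  rewrite (eq_bigr (fun x => Num.min (p x) (q x) * (y == x)%:R)); last first.
    by move=> x _; rewrite eq_sym; case: eqP => [->//|_]; rewrite !mulr0.
  rewrite (sum_seq_delta (fun y => Num.min (p y) (q y)))//.
  rewrite (eq_bigr (fun x => a x * (b y / t))) => [|x _]; last by rewrite /=; ring.
  rewrite -mulr_suml -/t mulrCA btt// /b.
  by case: (leP (p y) (q y)); case: (leP (q y - p y) 0); lra.
have rsum (F : 'rV[R]_d -> 'rV[R]_d -> R) :
    \sum_(z <- r) w z * F z.1 z.2 = \sum_(x <- s) \sum_(y <- s) w (x, y) * F x y.
  by rewrite big_allpairs.
have w1 : \sum_(z <- r) w z = 1.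
  by rewrite big_allpairs -p1; exact: eq_big_seq.
have mur : discrete mu r w fst.
  move=> A mA; rewrite mup// (rsum (fun x _ => \1_A x)); congr EFin.
  by apply: eq_big_seq => x xs; rewrite -mulr_suml row.
have nur : discrete nu r w snd.
  move=> A mA; rewrite nuq// (rsum (fun _ y => \1_A y)) exchange_big; congr EFin.
  by apply: eq_big_seq => x xs; rewrite /= -mulr_suml col.
apply: le_trans (W1_discrete w0 w1 mur nur) _.
rewrite lee_fin -tE (rsum (@eucl_dist R d)).
apply: (@le_trans _ _ (\sum_(x <- s) a x * D)); last by rewrite -mulr_suml mulrC.
rewrite big_seq [leRHS]big_seq; apply: ler_sum => x xs.
apply: (@le_trans _ _ (\sum_(y <- s) b y * (a x / t * D))).
  rewrite big_seq [leRHS]big_seq; apply: ler_sum => y ys; rewrite /w /=.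
  have -> : b y * (a x / t * D) = a x * b y / t * D by ring.
  rewrite mulrDl; case: eqP => [->|_]; last first.
    rewrite mulr0 mul0r add0r ler_wpM2l ?distD//.
    by rewrite mulr_ge0 ?invr_ge0// mulr_ge0.
  rewrite eucl_distxx !mulr0 addr0 mulr_ge0 ?invr_ge0//.
    by rewrite !mulr_ge0 ?invr_ge0.
  by rewrite -(eucl_distxx y) distD.
by rewrite -mulr_suml bt mulrA mulrCA att.
Qed.

(** The mixture [(1 - t) p + t delta_x] is indexed by pairs [(y, b)], where
    [b = true] marks the part of the mass of [y] that is moved to [x]. Mixtures
    for different [x] and [p] itself (each [(y, b)] placed at [y]) then have the
    same indices and weights, as [W1_discrete] requires. *)
Definition mixture_points (R : realType) (d : nat) (s : seq 'rV[R]_d) :=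
  [seq (y, b) | y <- s, b <- [:: true; false]].

Definition mixture_weight (R : realType) (d : nat) (p : 'rV[R]_d -> R)
  (t : R) (z : 'rV[R]_d * bool) : R := (if z.2 then t else 1 - t) * p z.1.

Definition mixture_place (R : realType) (d : nat) (x : 'rV[R]_d)
  (z : 'rV[R]_d * bool) : 'rV[R]_d := if z.2 then x else z.1.

Lemma sum_mixture (R : realType) (d : nat) (s : seq 'rV[R]_d)
    (p : 'rV[R]_d -> R) (t : R) (F : 'rV[R]_d * bool -> R) :
  \sum_(z <- mixture_points s) mixture_weight p t z * F z =
  t * (\sum_(y <- s) p y * F (y, true)) +
  (1 - t) * (\sum_(y <- s) p y * F (y, false)).
Proof.
rewrite /mixture_points big_allpairs /= !mulr_sumr -big_split /=.
apply: eq_bigr => y _.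
by rewrite !big_cons big_nil /mixture_weight /= addr0 !mulrA.
Qed.

(** * Entropic mirror descent on a finite set *)

(** The summand of the Kullback-Leibler divergence, corrected by [b - a], which
    cancels between probability vectors, dominates that of the squared Hellinger
    distance: apply [ln z <= z - 1] to [z = sqrt (b / a)]. *)
Lemma sqr_sqrt_sub_le_kl (R : realType) (a b : R) : 0 < a -> 0 < b ->
  (Num.sqrt a - Num.sqrt b) ^+ 2 <= a * (ln a - ln b) - a + b.
Proof.
move=> a0 b0; set u := Num.sqrt a; set v := Num.sqrt b.
have u0 : 0 < u by rewrite sqrtr_gt0.
have v0 : 0 < v by rewrite sqrtr_gt0.
have aE : a = u ^+ 2 by rewrite sqr_sqrtr// ltW.
have bE : b = v ^+ 2 by rewrite sqr_sqrtr// ltW.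
have lnD : ln v - ln u <= v / u - 1.
  rewrite -ln_div ?posrE// -[X in ln X](_ : 1 + (v / u - 1) = _); last by ring.
  by apply: le_ln1Dx; rewrite ltrBDl subrr divr_gt0.
have : u ^+ 2 * (ln v - ln u) <= u ^+ 2 * (v / u - 1).
  by rewrite ler_pM2l// exprn_gt0.
rewrite aE bE !lnXn//.
have -> : u ^+ 2 * (v / u - 1) = u * v - u ^+ 2 by field; rewrite gt_eqF.
rewrite !mulr2n; lra.
Qed.

(** Pinsker's inequality up to a factor 2. In
    [|p - q| = |sqrt p - sqrt q| * (sqrt p + sqrt q)] the AM-GM inequality with
    weight [c] bounds the sum of [|p - q|], twice the total variation [t], by
    [c / 2] times the divergence plus [2 / c]; then take [c = 2 / t]. *)
Lemma pinsker (R : realType) (T : eqType) (s : seq T) (p q : T -> R) :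
  {in s, forall x, 0 < p x} -> {in s, forall x, 0 < q x} ->
  \sum_(x <- s) p x = 1 -> \sum_(x <- s) q x = 1 ->
  (2^-1 * \sum_(x <- s) `|p x - q x|) ^+ 2 <=
  \sum_(x <- s) p x * (ln (p x) - ln (q x)).
Proof.
move=> p0 q0 p1 q1; set t := 2^-1 * _; set kl := \sum_(x <- s) _.
have klE : kl = \sum_(x <- s) (p x * (ln (p x) - ln (q x)) - p x + q x).
  by rewrite big_split sumrB /= p1 q1 subrK.
have bound c : 0 < c -> \sum_(x <- s) `|p x - q x| <= c / 2 * kl + 2 / c.
  move=> c0; rewrite klE.
  have -> : 2 / c = \sum_(x <- s) ((p x + q x) / c).
    by rewrite -mulr_suml big_split /= p1 q1.
  rewrite mulr_sumr -big_split /= big_seq [leRHS]big_seq.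
  apply: ler_sum => x xs.
  have [px qx] := (p0 x xs, q0 x xs).
  apply: le_trans (lerD (ler_wpM2l _ (sqr_sqrt_sub_le_kl px qx)) (lexx _)).
    2: by rewrite divr_ge0// ltW.
  set u := Num.sqrt (p x); set v := Num.sqrt (q x).
  have uE : p x = u ^+ 2 by rewrite sqr_sqrtr// ltW.
  have vE : q x = v ^+ 2 by rewrite sqr_sqrtr// ltW.
  rewrite uE vE subr_sqr normrM [`|u + v|]ger0_norm ?addr_ge0 ?sqrtr_ge0//.
  rewrite -[X in c / 2 * X]real_normK ?num_real//.
  set e := `|u - v|.
  rewrite -(ler_pM2l c0).
  have -> : c * (c / 2 * e ^+ 2 + (u ^+ 2 + v ^+ 2) / c) =
    (c * e) ^+ 2 / 2 + (u ^+ 2 + v ^+ 2) by field; rewrite gt_eqF.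
  have := sqr_ge0 (c * e - (u + v)); have := sqr_ge0 (u - v); nra.
have kl0 : 0 <= kl.
  rewrite klE big_seq; apply: sumr_ge0 => x xs.
  exact: le_trans (sqr_ge0 _) (sqr_sqrt_sub_le_kl (p0 x xs) (q0 x xs)).
have : 0 <= t by rewrite mulr_ge0// sumr_ge0.
rewrite le_eqVlt => /predU1P[<-|t0]; first by rewrite expr0n.
have := bound _ (divr_gt0 (ltr0n R 2) t0).
have -> : \sum_(x <- s) `|p x - q x| = 2 * t by rewrite /t mulrA divff ?mul1r.
have -> : 2 / t / 2 * kl + 2 / (2 / t) = kl / t + t by field; rewrite gt_eqF.
rewrite -(ler_pM2l t0).
have -> : t * (kl / t + t) = kl + t ^+ 2 by field; rewrite gt_eqF.
nra.
Qed.

(** Since [lam * f] and [lam * g] are, up to constants, the log-ratios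
    [ln (p / q)] and [ln (p / p')],
    [lam * <g, q - r>] equals [sum r * ln (p' / p) - KL(q | p) - KL(p' | q)
    + lam * <g - f, q - p'>]. With [T1] and [T2] the total variation distances
    of [q] to [p] and of [p'] to [q], the last term is at most
    [2 * T1 * T2 <= T1 ^+ 2 + T2 ^+ 2], which the two divergences absorb. *)
Lemma mirror_prox_step (R : realType) (T : eqType) (s : seq T) (lam M cq cp : R)
    (p q p' r f g : T -> R) :
  {in s, forall x, 0 < p x} -> {in s, forall x, 0 < q x} ->
  {in s, forall x, 0 < p' x} ->
  \sum_(x <- s) p x = 1 -> \sum_(x <- s) q x = 1 -> \sum_(x <- s) p' x = 1 ->
  \sum_(x <- s) r x = 1 ->
  {in s, forall x, ln (q x) - ln (p x) = - lam * f x - cq} ->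
  {in s, forall x, ln (p' x) - ln (p x) = - lam * g x - cp} ->
  0 <= lam -> lam * M <= 1 ->
  {in s, forall x, `|g x - f x| <= M * (2^-1 * \sum_(y <- s) `|q y - p y|)} ->
  lam * \sum_(x <- s) (q x - r x) * g x <=
  \sum_(x <- s) r x * (ln (p' x) - ln (p x)).
Proof.
move=> p0 q0 p'0 p1 q1 p'1 r1 lnq lnp' lam0 lamM gf.
set T1 := 2^-1 * _ in gf; pose T2 := 2^-1 * \sum_(x <- s) `|p' x - q x|.
have K1 : T1 ^+ 2 <= \sum_(x <- s) q x * (ln (q x) - ln (p x)) by exact: pinsker.
have K2 : T2 ^+ 2 <= \sum_(x <- s) p' x * (ln (p' x) - ln (q x)) by exact: pinsker.
have T10 : 0 <= T1 by rewrite mulr_ge0// sumr_ge0.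
have T20 : 0 <= T2 by rewrite mulr_ge0// sumr_ge0.
have cross : lam * \sum_(x <- s) (g x - f x) * (q x - p' x) <= T1 ^+ 2 + T2 ^+ 2.
  apply: (@le_trans _ _ (lam * (\sum_(x <- s) M * T1 * `|p' x - q x|))).
    rewrite ler_wpM2l// big_seq [leRHS]big_seq; apply: ler_sum => x xs.
    apply: le_trans (ler_norm _) _; rewrite normrM distrC [`|q x - _|]distrC.
    by rewrite ler_wpM2r// distrC gf.
  rewrite -mulr_sumr.
  have -> : \sum_(x <- s) `|p' x - q x| = 2 * T2 by rewrite /T2 mulrA divff ?mul1r.
  apply: (@le_trans _ _ (2 * T1 * T2)); last by have := sqr_ge0 (T1 - T2); nra.
  have -> : lam * (M * T1 * (2 * T2)) = lam * M * (2 * T1 * T2) by ring.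
  by rewrite ler_piMl// mulr_ge0// mulr_ge0.
have ident : lam * (\sum_(x <- s) (q x - r x) * g x) =
    \sum_(x <- s) r x * (ln (p' x) - ln (p x))
    - \sum_(x <- s) q x * (ln (q x) - ln (p x))
    - \sum_(x <- s) p' x * (ln (p' x) - ln (q x))
    + lam * \sum_(x <- s) (g x - f x) * (q x - p' x).
  apply/eqP; rewrite eq_sym -subr_eq0 !mulr_sumr -!sumrB -big_split -sumrB /=.
  rewrite (eq_big_seq (fun x => - cp * r x + (cp - cq) * p' x + cq * q x)).
    by rewrite !big_split /= -!mulr_sumr r1 p'1 q1; apply/eqP; ring.
  move=> x xs /=; have -> : ln (p' x) - ln (q x) =
    (ln (p' x) - ln (p x)) - (ln (q x) - ln (p x)) by ring.
  by rewrite lnp'// lnq//; ring.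
by rewrite ident; lra.
Qed.

(** * Mean field equilibria *)

Section finite_support.
Variables (R : realType) (d : nat) (Omega : set 'rV[R]_d) (s : seq 'rV[R]_d).
Hypothesis (Omega_meas : measurable Omega).
Hypothesis (s_uniq : uniq s) (s_sub : [set` s] `<=` Omega).
Implicit Types (mu nu : probability 'rV[R]_d R) (f : 'rV[R]_d -> R).

Definition mean (mu : probability 'rV[R]_d R) (f : 'rV[R]_d -> R) : R :=
  \sum_(x <- s) mass mu x * f x.

Lemma probs_seq_sub mu : probs [set` s] mu -> probs Omega mu.
Proof.
move=> mus; apply/eqP; rewrite eq_le probability_le1// -mus.
by rewrite le_measure ?inE//; exact: measurable_set_seq.
Qed.

Lemma pairing_discrete mu (I : eqType) (r : seq I) (w : I -> R)
    (z : I -> 'rV[R]_d) f :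
  (forall i, 0 <= w i) -> discrete mu r w z ->
  {in r, forall i, Omega (z i)} -> measurable_fun Omega f ->
  pairing Omega f mu = \sum_(i <- r) w i * f (z i).
Proof.
move=> w0 mud zO mf; rewrite /pairing (discrete_integral w0 mud)//.
by apply: eq_big_seq => i ir; rewrite indicE mem_set ?mulr1//; exact: zO.
Qed.

Lemma pairing_mean mu f : probs [set` s] mu -> measurable_fun Omega f ->
  pairing Omega f mu = mean mu f.
Proof.
move=> mus mf.
exact: (pairing_discrete (mass_ge0 mu) (probs_seq_discrete s_uniq mus)).
Qed.

Lemma sum_mass mu : probs [set` s] mu -> \sum_(x <- s) mass mu x = 1.
Proof.
move=> mus; apply: EFin_inj; rewrite -[RHS]mus.
rewrite (probs_seq_discrete s_uniq mus); last exact: measurable_set_seq.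
congr EFin.
by apply: eq_big_seq => x xs; rewrite indicE mem_set ?mulr1.
Qed.

(** A Gibbs reweighting keeps the support, and its normalizing factor becomes
    the additive constant [c] in logarithmic form. *)
Lemma gibbs_mass lam mu nu f :
  probs [set` s] mu -> {in s, forall x, 0 < mass mu x} ->
  measurable_fun Omega f -> is_gibbs Omega lam f mu nu ->
  [/\ probs [set` s] nu, {in s, forall x, 0 < mass nu x} &
      exists c, {in s, forall x, ln (mass nu x) - ln (mass mu x) = - lam * f x - c}].
Proof.
move=> mus mu0 mf gibbs; set e := fun x => expR (- lam * f x).
have me : measurable_fun Omega e.
  apply: (measurableT_comp (@measurable_expR R)).
  exact: measurable_funM.
pose Z := \sum_(x <- s) mass mu x * e x.
have mud := probs_seq_discrete s_uniq mus.
have ZE : \int[mu]_(x in Omega) e x = Z by exact: pairing_mean mus me.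
have s_n0 : exists x, x \in s.
  have := sum_mass mus; case: (s) => [|x l]; last by exists x; rewrite mem_head.
  by rewrite big_nil => /esym/eqP; rewrite oner_eq0.
have Z0 : 0 < Z.
  have [x xs] := s_n0; rewrite /Z (bigD1_seq x)//= ltr_pwDl//.
    by rewrite mulr_gt0 ?expR_gt0 ?mu0.
  by apply: sumr_ge0 => y _; rewrite mulr_ge0 ?mass_ge0 ?expR_ge0.
have nuE A : measurable A ->
    nu A = ((\sum_(x <- s) mass mu x * \1_A x * e x) / Z)%:E.
  move=> mA; rewrite gibbs// ZE; congr (_ / _)%:E.
  have mAO : measurable (A `&` Omega) by exact: measurableI.
  rewrite (discrete_integral (mass_ge0 mu) mud)//; last first.
    exact: measurable_funS me.
  apply: eq_big_seq => x xs; rewrite !indicE in_setI.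
  by rewrite (mem_set (s_sub xs)) andbT.
have massE' : {in s, forall x, mass nu x = mass mu x * e x / Z}.
  move=> x xs; rewrite /mass nuE; last exact: measurable_set1_rV.
  rewrite /=; congr (_ / _).
  rewrite -[RHS](sum_seq_delta (fun y => mass mu y * e y) s_uniq xs).
  apply: eq_bigr => y _; rewrite indicE -mulrA [_%:R * _]mulrC mulrA.
  by congr (_ * (nat_of_bool _)%:R); apply/idP/eqP => [/set_mem ->//|->]; exact: mem_set.
have nu0 : {in s, forall x, 0 < mass nu x}.
  by move=> x xs; rewrite massE'// divr_gt0// mulr_gt0 ?expR_gt0 ?mu0.
split => //.
  rewrite /probs /= nuE; last exact: measurable_set_seq.
  rewrite (_ : \sum_(x <- s) _ = Z) ?divff ?gt_eqF//.
  by apply: eq_big_seq => x xs; rewrite indicE mem_set ?mulr1.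
exists (ln Z) => x xs; rewrite massE'// ln_div ?posrE ?mulr_gt0 ?expR_gt0 ?mu0//.
by rewrite lnM ?posrE ?expR_gt0 ?mu0// expRK; ring.
Qed.

Lemma average_mass (nu : nat -> probability 'rV[R]_d R) (K : nat) :
  (0 < K)%N -> (forall k, probs [set` s] (nu k)) ->
  probs [set` s] (average nu K) /\
  forall f, K%:R * mean (average nu K) f = \sum_(k < K) mean (nu k) f.
Proof.
move=> K0 nus.
have Kn0 : K%:R != 0 :> R by rewrite pnatr_eq0 -lt0n.
have ps : probs [set` s] (average nu K).
  rewrite /probs /= averageE// (eq_bigr (fun=> 1%E)); last by move=> k _; exact: nus.
  by rewrite sumEFin big_const_ord iter_addr_0 -EFinM mulVf.
split => // f; rewrite /mean exchange_big /= mulr_sumr; apply: eq_bigr => x _.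
rewrite -mulr_suml mulrA; congr (_ * _); apply: EFin_inj.
rewrite EFinM -massE averageE// muleA -EFinM divff// mul1e -sumEFin.
by apply: eq_bigr => k _; rewrite massE.
Qed.

Lemma mixture_weight_ge0 mu (t : R) z :
  0 <= t <= 1 -> 0 <= mixture_weight (mass mu) t z.
Proof.
by move=> /andP[t0 t1]; case: z => y []; rewrite mulr_ge0 ?mass_ge0 ?subr_ge0.
Qed.

Lemma sum_mixture_weight mu (t : R) : probs [set` s] mu ->
  \sum_(z <- mixture_points s) mixture_weight (mass mu) t z = 1.
Proof.
move=> mus; have := sum_mixture s (mass mu) t (fun=> 1).
under eq_bigr do rewrite mulr1.
move=> ->; under eq_bigr do rewrite mulr1.
by rewrite sum_mass// !mulr1 addrC subrK.
Qed.
End finite_support.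

Section mean_field_game.
Variables (R : realType) (d : nat) (Omega : set 'rV[R]_d).
Variables (J : probability 'rV[R]_d R -> 'rV[R]_d -> R) (Lm Lx : R).
Hypothesis (Omega_compact : compact Omega).
Hypothesis (diam_gt0 : 0 < diam Omega).
Hypothesis (J_continuous : forall rho, probs Omega rho ->
  {within Omega, continuous (J rho)}).
Hypothesis (J_monotone : lasry_lions_monotone Omega J).
Hypothesis (Lm_gt0 : 0 < Lm).
Hypothesis (J_lip_measure : forall rho sigma,
  probs Omega rho -> probs Omega sigma ->
  (supnorm Omega (fun x => (J rho x - J sigma x)%R)
     <= Lm%:E * W1 rho sigma)%E).
Hypothesis (Lx_gt0 : 0 < Lx).
Hypothesis (J_lip_space : forall rho x y, probs Omega rho ->
  Omega x -> Omega y -> `|J rho x - J rho y| <= Lx * eucl_dist x y).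
Variable s : seq 'rV[R]_d.
Hypothesis (s_uniq : uniq s) (s_sub : [set` s] `<=` Omega).

Let Omega_meas : measurable Omega := compact_measurable_rV Omega_compact.
Let D := diam Omega.
Local Notation mean := (mean s).
Local Notation probs_s := (probs [set` s]).

(** A positive diameter forces the distances to be bounded, because an unbounded
    set has supremum [0] by convention. *)
Lemma eucl_dist_le_diam x y : Omega x -> Omega y -> eucl_dist x y <= D.
Proof.
move=> Ox Oy; rewrite /D /diam; set S := [set _ | _ in _ & _ in _].
have [hS|nS] := pselect (has_sup S); last first.
  by move: diam_gt0; rewrite /diam sup_out// ltxx.
by apply: ub_le_sup; [case: hS|exists x => //; exists y].
Qed.

Lemma J_close rho sigma c x : probs Omega rho -> probs Omega sigma ->
  (W1 rho sigma <= c%:E)%E -> Omega x -> `|J rho x - J sigma x| <= Lm * c.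
Proof.
move=> Or Os W Ox; rewrite -lee_fin EFinM.
apply: (@le_trans _ _ (Lm%:E * W1 rho sigma)%E); last first.
  by rewrite lee_pmul2l ?lte_fin.
apply: le_trans (J_lip_measure Or Os).
by apply: ereal_sup_ubound; exists x.
Qed.

Lemma J_measurable rho : probs Omega rho -> measurable_fun Omega (J rho).
Proof.
move=> Or; apply: within_continuous_measurable_fun => //.
exact: J_continuous.
Qed.

Let probs_sub mu : probs_s mu -> probs Omega mu.
Proof. exact: probs_seq_sub. Qed.

Lemma monotone_mean rho sigma : probs_s rho -> probs_s sigma ->
  mean sigma (J rho) - mean rho (J rho) <= mean sigma (J sigma) - mean rho (J sigma).
Proof.
move=> rs ss; have [Or Os] := (probs_sub rs, probs_sub ss).
have mf : measurable_fun Omega (fun x => J sigma x - J rho x).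
  by apply: measurable_funB; exact: J_measurable.
have := J_monotone Os Or.
rewrite /= !(pairing_mean Omega_meas s_uniq s_sub)//.
have dist mu : mean mu (fun x => J sigma x - J rho x) =
    mean mu (J sigma) - mean mu (J rho).
  by rewrite -sumrB; apply: eq_bigr => x _; rewrite mulrBr.
by rewrite !dist; lra.
Qed.

Section iterates.
Variables (lam : R) (mu0 : probability 'rV[R]_d R).
Variables (mu nu : nat -> probability 'rV[R]_d R).
Hypothesis (lam_gt0 : 0 < lam) (lam_le : lam * (Lm * D) <= 1).
Hypothesis (mu0_prob : probs_s mu0).
Hypothesis (mu0_pos : {in s, forall x, 0 < mass mu0 x}).
Hypothesis (mu_nu : KL_mirror_prox Omega J lam mu0 mu nu).

Lemma mu_support k : probs_s (mu k) /\ {in s, forall x, 0 < mass (mu k) x}.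
Proof.
case: mu_nu => mu_0 step; elim: k => [|k [IH1 IH2]]; first by rewrite mu_0.
have [nuG muG] := step k.
have [nus _ _] := gibbs_mass Omega_meas s_uniq s_sub IH1 IH2
  (J_measurable (probs_sub IH1)) nuG.
by have [] := gibbs_mass Omega_meas s_uniq s_sub IH1 IH2
  (J_measurable (probs_sub nus)) muG.
Qed.

Lemma nu_support k : probs_s (nu k).
Proof.
have [mus mu_gt0] := mu_support k; have [nuG _] := mu_nu.2 k.
by have [] := gibbs_mass Omega_meas s_uniq s_sub mus mu_gt0
  (J_measurable (probs_sub mus)) nuG.
Qed.

Lemma iterate_descent k rho : probs_s rho ->
  lam * (mean (nu k) (J (nu k)) - mean rho (J (nu k))) <=
  \sum_(x <- s) mass rho x * (ln (mass (mu k.+1) x) - ln (mass (mu k) x)).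
Proof.
move=> rs; have [mus mu_gt0] := mu_support k; have [mus' mu_gt0'] := mu_support k.+1.
have [nuG muG] := mu_nu.2 k; have nus := nu_support k.
have [_ nu_gt0 [cq lnq]] := gibbs_mass Omega_meas s_uniq s_sub mus mu_gt0
  (J_measurable (probs_sub mus)) nuG.
have [_ _ [cp lnp]] := gibbs_mass Omega_meas s_uniq s_sub mus mu_gt0
  (J_measurable (probs_sub nus)) muG.
rewrite -sumrB (eq_bigr (fun x => (mass (nu k) x - mass rho x) * J (nu k) x)).
  2: by move=> x _; rewrite mulrBl.
apply: (mirror_prox_step mu_gt0 nu_gt0 mu_gt0' _ _ _ _ lnq lnp _ lam_le) => //;
  rewrite ?(sum_mass s_uniq)//; first exact: ltW.
move=> x xs; rewrite -mulrA; apply: J_close; [exact: probs_sub..| |exact: s_sub].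
apply: (W1_le_total_variation s_uniq (mass_ge0 _) (mass_ge0 _));
  rewrite ?(sum_mass s_uniq)//; do ?exact: probs_seq_discrete.
by move=> y z ys zs; apply: eucl_dist_le_diam; exact: s_sub.
Qed.

(** The descent estimates telescope to
    [sum_x rho(x) * (ln (mu_K(x)) - ln (mu_0(x)))], where
    [ln (mu_K(x)) <= 0] and [ln (mu_0(x)) >= ln m]. Monotonicity then evaluates
    [J] at [rho] instead of [nu k], which makes the bound linear in [nu k]. *)
Lemma mirror_prox_dual_gap K rho m : (0 < K)%N -> 0 < m ->
  {in s, forall x, m <= mass mu0 x} -> probs_s rho ->
  mean (average nu K) (J rho) - mean rho (J rho) <= ln (1 / m) / (lam * K%:R).
Proof.
move=> K0 m0 mle rs.
have Kp : 0 < K%:R :> R by rewrite ltr0n.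
have [_ avgE] := average_mass K0 nu_support.
have tele : lam * (\sum_(k < K) (mean (nu k) (J (nu k)) - mean rho (J (nu k)))) <=
    \sum_(x <- s) mass rho x * (ln (mass (mu K) x) - ln (mass (mu 0%N) x)).
  elim: (K) => [|n IH].
    by rewrite big_ord0 mulr0 big1// => x _; rewrite subrr mulr0.
  rewrite big_ord_recr mulrDr /=.
  apply: le_trans (lerD IH (iterate_descent n rs)) _.
  by rewrite -big_split /= le_eqVlt; apply/orP; left; apply/eqP;
    apply: eq_bigr => x _; ring.
have last : \sum_(x <- s) mass rho x * (ln (mass (mu K) x) - ln (mass (mu 0%N) x))
    <= ln (1 / m).
  apply: (@le_trans _ _ (\sum_(x <- s) mass rho x * ln (1 / m))); last first.
    by rewrite -mulr_suml (sum_mass s_uniq)// mul1r.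
  rewrite big_seq [leRHS]big_seq; apply: ler_sum => x xs.
  rewrite ler_wpM2l ?mass_ge0// ln_div ?posrE// ln1 sub0r mu_nu.1.
  have muK : mass (mu K) x <= 1.
    by rewrite -lee_fin -massE probability_le1//; exact: measurable_set1_rV.
  have := ln_le0 muK; have : ln m <= ln (mass mu0 x).
    by rewrite ler_ln ?posrE ?mle// mu0_pos.
  lra.
rewrite ler_pdivlMr ?mulr_gt0// (le_trans _ (le_trans tele last))//.
rewrite mulrC -mulrA ler_pM2l// mulrBr avgE.
have -> : K%:R * mean rho (J rho) = \sum_(k < K) mean rho (J rho).
  by rewrite sumr_const card_ord mulr_natl.
by rewrite -sumrB; apply: ler_sum => k _; apply: monotone_mean => //; exact: nu_support.
Qed.
End iterates.

(** The gap bound is available for probabilities on [s] only. It is applied to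
    the mixture [P'] of [sigma] with the Dirac mass at a point [y] of [s] near
    [x] and carried over to the mixture [P] at [x]; as both mixtures share the
    part [(1 - t) sigma], this costs [t * h] in [W1]. *)
Lemma equilibrium_of_dual_gap sigma (B h : R) :
  probs_s sigma -> 0 < h ->
  (forall x, Omega x -> exists2 y, y \in s & eucl_dist y x <= h) ->
  (forall rho, probs_s rho -> mean sigma (J rho) - mean rho (J rho) <= B) ->
  let eps := B + (2 * Lm + Lx) * h in
  0 < eps -> eps <= 2 * Lm * D -> Omega !=set0 ->
  mean_field_equilibrium Omega J (2 * Num.sqrt (2 * Lm * D * eps)) sigma.
Proof.
move=> ss h0 net gap eps eps0 epsD On0; split; first exact: probs_sub.
have Os := probs_sub ss.
have D0 : 0 < D by [].
pose a := 2 * Lm * D; have a0 : 0 < a by rewrite /a !mulr_gt0.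
(* The minimizer of [eps / t + a * t]; the bound on [eps] makes it at most 1. *)
pose t := Num.sqrt (eps / a).
have t0 : 0 < t by rewrite sqrtr_gt0 divr_gt0.
have t1 : t <= 1.
  by rewrite -sqrtr1 ler_wsqrtr// ler_pdivrMr// mul1r.
have tt : 0 <= t <= 1 by rewrite (ltW t0).
have epsE : eps = a * t ^+ 2.
  rewrite sqr_sqrtr; last by apply: ltW; exact: divr_gt0.
  by rewrite mulrCA divff ?mulr1 ?gt_eqF.
have -> : Num.sqrt (2 * Lm * D * eps) = a * t.
  rewrite epsE -/a (_ : a * (a * t ^+ 2) = (a * t) ^+ 2); last by ring.
  by rewrite sqrtr_sqr ger0_norm// mulr_ge0 ?ltW.
rewrite -lerBlDr; apply: lb_le_inf.
  by case: On0 => x Ox; exists (J sigma x); exists x.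
move=> _ [x Ox <-]; rewrite -[X in X - _ <= _]/(pairing Omega (J sigma) sigma).
rewrite (pairing_mean Omega_meas s_uniq s_sub ss (J_measurable Os)).
have [y ys yx] := net x Ox.
have Oy : Omega y by exact: s_sub.
have w0 z := mixture_weight_ge0 sigma z tt.
have place (v : 'rV[R]_d) (A : set 'rV[R]_d) : [set` s] `<=` A -> A v ->
    {in mixture_points s, forall z, A (mixture_place v z)}.
  by move=> sA Av _ /allpairsP[[u b] [/= us _ ->]]; rewrite /mixture_place/=;
    case: b => //; exact: sA.
have w1 := sum_mixture_weight s_uniq t ss.
have [P Pd] := discrete_probability (mixture_place x) w0 w1.
have [P' Pd'] := discrete_probability (mixture_place y) w0 w1.
have OP : probs Omega P by apply: (probs_discrete _ Pd (place x Omega _ _)).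
have sP' : probs_s P'.
  by apply: (probs_discrete _ Pd' (place y _ _ _)) => //; exact: measurable_set_seq.
have OP' := probs_sub sP'.
have sd : discrete sigma (mixture_points s) (mixture_weight (mass sigma) t) fst.
  move=> A mA; rewrite (probs_seq_discrete s_uniq ss)//.
  rewrite (sum_mixture _ _ _ (fun z => \1_A z.1))/=.
  by rewrite -mulrDl addrC subrK mul1r.
have WPs : (W1 P sigma <= (t * D)%:E)%E.
  apply: le_trans (W1_discrete w0 w1 Pd sd) _; rewrite lee_fin.
  rewrite (sum_mixture _ _ _ (fun z => eucl_dist (mixture_place x z) z.1))/=.
  rewrite [X in _ + _ * X](_ : _ = 0) ?mulr0 ?addr0; last first.
    by rewrite big1// => z _; rewrite eucl_distxx mulr0.
  rewrite ler_pM2l// -[leRHS]mul1r -(sum_mass s_uniq ss) [leRHS]mulr_suml.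
  rewrite big_seq [leRHS]big_seq; apply: ler_sum => z zs.
  by rewrite ler_wpM2l ?mass_ge0// eucl_dist_le_diam//; exact: s_sub.
have WPP' : (W1 P' P <= (t * h)%:E)%E.
  apply: le_trans (W1_discrete w0 w1 Pd' Pd) _; rewrite lee_fin.
  rewrite (sum_mixture _ _ _
    (fun z => eucl_dist (mixture_place y z) (mixture_place x z)))/=.
  rewrite [X in _ + _ * X](_ : _ = 0) ?mulr0 ?addr0; last first.
    by rewrite big1// => z _; rewrite eucl_distxx mulr0.
  by rewrite ler_pM2l// /mixture_place /= -mulr_suml sum_mass// mul1r.
have gapP' : t * (mean sigma (J P') - J P' y) <= B.
  have := gap _ sP'; rewrite -(pairing_mean Omega_meas s_uniq s_sub sP')//.
    2: exact: J_measurable.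
  rewrite (pairing_discrete Omega_meas w0 Pd' (place y _ s_sub Oy)).
    2: exact: J_measurable.
  rewrite (sum_mixture _ _ _ (fun z => J P' (mixture_place y z)))/=.
  rewrite /mixture_place /= -mulr_suml sum_mass// mul1r -/(mean sigma (J P')).
  lra.
have mean_close (f g : 'rV[R]_d -> R) c : (forall z, Omega z -> `|f z - g z| <= c) ->
    mean sigma f <= mean sigma g + c.
  move=> fg; have -> : c = \sum_(z <- s) mass sigma z * c.
    by rewrite -mulr_suml sum_mass// mul1r.
  rewrite -big_split /=.
  rewrite [leLHS]big_seq [leRHS]big_seq; apply: ler_sum => z zs.
  rewrite -mulrDr ler_wpM2l ?mass_ge0// -lerBlDl.
  exact: le_trans (ler_norm _) (fg z (s_sub zs)).
have closeP z : Omega z -> `|J sigma z - J P z| <= Lm * (t * D).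
  by move=> Oz; rewrite distrC; exact: J_close.
have closeP' z : Omega z -> `|J P z - J P' z| <= Lm * (t * h).
  by move=> Oz; rewrite distrC; exact: J_close.
have M1 := mean_close _ _ _ closeP; have M2 := mean_close _ _ _ closeP'.
have := closeP x Ox; have := closeP' x Ox.
rewrite !ler_norml => /andP[X2 _] /andP[X1 _].
have := J_lip_space OP' Oy Ox; rewrite ler_norml => /andP[_ X3].
have X4 : Lx * eucl_dist y x <= Lx * h by rewrite ler_pM2l.
have tLh : t * (2 * (Lm * (t * h)) + Lx * h) <= (2 * Lm + Lx) * h.
  have t2 : t * t <= 1 by rewrite mulr_ile1// ltW.
  have := ler_wpM2l (ltW (mulr_gt0 Lm_gt0 h0)) t2.
  have := ler_wpM2l (ltW (mulr_gt0 Lx_gt0 h0)) t1.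
  lra.
have main : t * (mean sigma (J sigma) - J sigma x - 2 * (Lm * (t * D))) <= eps.
  rewrite /eps; apply: le_trans (lerD gapP' tLh).
  by rewrite -mulrDr ler_pM2l//; lra.
move: main; rewrite epsE.
have -> : a * t ^+ 2 = t * (a * t) by ring.
rewrite ler_pM2l// /a; lra.
Qed.
End mean_field_game.

(** * Convergence of the averaged iterates *)

Theorem mainTheorem3 (R : realType) (d : nat) (Omega : set 'rV[R]_d)
    (J : probability 'rV[R]_d R -> 'rV[R]_d -> R)
    (Lm Lx lambda : R)
    (X : R -> set 'rV[R]_d) (Q : R -> 'rV[R]_d -> 'rV[R]_d)
    (mu0 : R -> probability 'rV[R]_d R)
    (mu nu : R -> nat -> probability 'rV[R]_d R)
    (Omega_nonempty : Omega !=set0)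
    (Omega_compact : compact Omega)
    (diam_gt0 : 0 < diam Omega)
    (J_continuous : forall rho, probs Omega rho ->
       {within Omega, continuous (J rho)})
    (J_monotone : lasry_lions_monotone Omega J)
    (Lm_gt0 : 0 < Lm)
    (J_lip_measure : forall rho sigma, probs Omega rho -> probs Omega sigma ->
       (supnorm Omega (fun x => (J rho x - J sigma x)%R)
          <= Lm%:E * W1 rho sigma)%E)
    (Lx_gt0 : 0 < Lx)
    (J_lip_space : forall rho x y, probs Omega rho -> Omega x -> Omega y ->
       `|J rho x - J rho y| <= Lx * eucl_dist x y)
    (X_finite : forall h, 0 < h -> finite_set (X h))
    (X_sub : forall h, 0 < h -> X h `<=` Omega)
    (Q_into : forall h, 0 < h -> forall x, Omega x -> X h (Q h x))
    (Q_measurable : forall h, 0 < h -> measurable_fun Omega (Q h))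
    (Q_close : forall h, 0 < h ->
       (ereal_sup [set (eucl_dist (Q h x) x)%:E | x in Omega] <= h%:E)%E)
    (mu0_prob : forall h, 0 < h -> probs (X h) (mu0 h))
    (mu0_pos : forall h, 0 < h -> forall x, X h x -> (0 < mu0 h [set x])%E)
    (lambda_gt0 : 0 < lambda)
    (lambda_lt : lambda < 1 / (Lm * diam Omega))
    (iterates : forall h, 0 < h ->
       KL_mirror_prox Omega J lambda (mu0 h) (mu h) (nu h)) :
  let D := diam Omega in
  (* an infimum over a nonempty finite set, hence a minimum *)
  let m h := inf [set fine (mu0 h [set x]) | x in X h] in
  let nubar K h := average (nu h) K in
  let eps K h := ln (1 / m h) / (lambda * K%:R) + (2 * Lm + Lx) * h in
  let delta K h := 2 * Num.sqrt (2 * Lm * D * eps K h) in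
  (forall h K, 0 < h -> (1 <= K)%N ->
     eps K h <= 2 * Lm * D ->
     mean_field_equilibrium Omega J (delta K h) (nubar K h))
  /\
  (forall dl, 0 < dl ->
     let eps_star := Num.min (2 * Lm * D) (dl ^+ 2 / (8 * Lm * D)) in
     forall h K, 0 < h -> (1 <= K)%N ->
       h <= eps_star / (2 * (2 * Lm + Lx)) ->
       2 * ln (1 / m h) / (lambda * eps_star) <= K%:R ->
       [/\ eps K h <= eps_star,
           delta K h <= dl &
           mean_field_equilibrium Omega J dl (nubar K h)]).
Proof.
move=> D m nubar eps delta.
have D0 : 0 < D by [].
have LD0 : 0 < 2 * Lm * D by rewrite !mulr_gt0.
have L0 : 0 < 2 * Lm + Lx by rewrite addr_gt0// mulr_gt0.
have support h : 0 < h -> exists s : seq 'rV[R]_d,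
    [/\ uniq s, X h = [set` s], [set` s] `<=` Omega &
        {in s, forall x, 0 < mass (mu0 h) x}].
  move=> h0; have /finite_seqP[s0 sE] := X_finite h h0.
  have XE : X h = [set` undup s0].
    by rewrite sE; apply/seteqP; split => x /=; rewrite mem_undup.
  exists (undup s0); split; rewrite -?XE ?undup_uniq//; first exact: X_sub.
  move=> x xs; rewrite -lte_fin -massE mu0_pos//.
  by rewrite XE.
(* [m h] is positive although it is only defined as an infimum, since the masses
   on the finite set [X h] have a positive lower bound [c]. *)
have m_bounds h (s : seq 'rV[R]_d) : 0 < h -> X h = [set` s] ->
    {in s, forall x, 0 < mass (mu0 h) x} ->
    [/\ 0 < m h, m h <= 1 & {in s, forall x, m h <= mass (mu0 h) x}].
  move=> h0 XE pos.
  have [x0 Ox0] := Omega_nonempty; have Xq := Q_into h h0 x0 Ox0.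
  have mle : {in s, forall x, m h <= mass (mu0 h) x}.
    move=> x xs; apply: ge_inf; last by exists x => //; rewrite XE.
    by exists 0 => _ [y _ <-]; exact: mass_ge0.
  have [c c0 cle] : exists2 c : R, 0 < c & {in s, forall x, c <= mass (mu0 h) x}.
    elim: (s) pos => [|x l IH] pos; first by exists 1.
    have [|c c0 cl] := IH; first by move=> y yl; rewrite pos// inE yl orbT.
    exists (Num.min c (mass (mu0 h) x)); first by rewrite lt_min c0 pos// mem_head.
    move=> y; rewrite inE => /predU1P[->|yl]; first by rewrite ge_min lexx orbT.
    by rewrite ge_min cl.
  split => //.
    apply: (lt_le_trans c0); apply: lb_le_inf.
      by exists (mass (mu0 h) (Q h x0)), (Q h x0).
    by move=> _ [x Xx <-]; apply: cle; move: Xx; rewrite XE.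
  apply: (@le_trans _ _ (mass (mu0 h) (Q h x0))).
    by apply: mle; move: Xq; rewrite XE.
  by rewrite -lee_fin -massE probability_le1//; exact: measurable_set1_rV.
have lam_le : lambda * (Lm * D) <= 1.
  by apply: ltW; rewrite -ltr_pdivlMr// mulr_gt0.
have partA h K : 0 < h -> (1 <= K)%N -> eps K h <= 2 * Lm * D ->
    mean_field_equilibrium Omega J (delta K h) (nubar K h).
  move=> h0 K1 epsD; have [s [us XE sO pos]] := support h h0.
  have [m0 m1 mle] := m_bounds h s h0 XE pos.
  have mu0s : probs [set` s] (mu0 h) by rewrite -XE; exact: mu0_prob.
  have nus k : probs [set` s] (nu h k).
    exact: (nu_support Omega_compact J_continuous us sO mu0s pos (iterates h h0)).
  have [avgs _] := average_mass K1 nus.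
  apply: (equilibrium_of_dual_gap Omega_compact _ J_continuous Lm_gt0
    J_lip_measure Lx_gt0 J_lip_space us sO avgs h0) => //.
  - move=> x Ox; exists (Q h x); first by have := Q_into h h0 x Ox; rewrite XE.
    rewrite -lee_fin; apply: le_trans (Q_close h h0).
    by apply: ereal_sup_ubound; exists x.
  - move=> rho rs.
    exact: (mirror_prox_dual_gap Omega_compact diam_gt0 J_continuous J_monotone
      Lm_gt0 J_lip_measure us sO lambda_gt0 lam_le mu0s pos (iterates h h0)).
  - rewrite ltr_wpDl ?mulr_gt0// divr_ge0//.
      by rewrite ln_ge0// ler_pdivlMr// mul1r.
    by rewrite mulr_ge0// ltW.
split => // dl dl0 es h K h0 K1 hle Kle.
have es0 : 0 < es by rewrite lt_min LD0 divr_gt0 ?exprn_gt0// !mulr_gt0.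
have K0 : 0 < K%:R :> R by rewrite ltr0n.
have epsle : eps K h <= es.
  have e1 : ln (1 / m h) / (lambda * K%:R) <= es / 2.
    move: Kle; rewrite !ler_pdivrMr ?mulr_gt0//.
    by rewrite (_ : es / 2 * _ = (K%:R * (lambda * es)) / 2); [lra|ring].
  have e2 : (2 * Lm + Lx) * h <= es / 2.
    move: hle; rewrite ler_pdivlMr ?mulr_gt0//; lra.
  by rewrite /eps; lra.
have deltale : delta K h <= dl.
  rewrite /delta (_ : dl = 2 * (dl / 2)); last by field.
  rewrite ler_pM2l// -[leRHS]ger0_norm ?divr_ge0 ?(ltW dl0)// -sqrtr_sqr.
  rewrite ler_wsqrtr//; apply: (@le_trans _ _ (2 * Lm * D * (dl ^+ 2 / (8 * Lm * D)))).
    by rewrite ler_pM2l// (le_trans epsle)// ge_min lexx orbT.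
  rewrite le_eqVlt; apply/orP; left; apply/eqP; field.
  by rewrite !gt_eqF.
split => //.
have esD : es <= 2 * Lm * D by rewrite ge_min lexx.
have [Op eqp] := partA h K h0 K1 (le_trans epsle esD).
split => //; apply: le_trans eqp _; by rewrite lerD2l.
Qed.
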